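(* Let $(X,\le)$ be a finite regular $\wedge$-semilattice of height $n$ with top level $\Omega$, let $t\in\{0,\ldots,n\}$, let $\beta\in\mathbb{C}^{\Omega}$ be a $t$-design of index $\lambda$, and let $a\in X$. For $s\in\{0,\ldots,t\}$ let $\lambda_s$ be the index of $\beta$ as an $s$-design. Then the following systems of equations hold, and they are equivalent. (a) (Mendelsohn equations) For all $r\in\{0,\ldots,t\}$, $$\sum_{s=r}^n \nu(r,s)\,\alpha_s(a)=\nu(r,h(a))\,\lambda_r.$$ The right-hand side admits the alternative expressions $$\nu(r,h(a))\,\lambda_r=\nu(r,h(a))\,\frac{\theta(r)}{\theta(t)}\,\lambda=\nu(r,h(a))\,\frac{\theta(r)}{\theta(0)}\,\#\beta.$$ (b) (K\''ohler parametrization) For all $r\in\{0,\ldots,t\}$, $$\alpha_r(a)=\sum_{s=r}^t\nu'(r,s)\,\nu(s,h(a))\,\lambda_s-\sum_{u=t+1}^n\Big(\sum_{s=r}^t\nu'(r,s)\,\nu(s,u)\Big)\alpha_u(a),$$ where the inner sum on the right-hand side admits the alternative form $$\sum_{s=r}^t\nu'(r,s)\,\nu(s,u)=-\sum_{s=t+1}^u\nu'(r,s)\,\nu(s,u).$$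
   Context: Let $(X,\le)$ be a finite non-empty $\wedge$-semilattice (poset in which any two elements have a meet); it has a bottom element $\bot$. For $a\le b$ in $X$, the length $\ell(a,b)$ is the largest $r$ such that there is a chain $a=x_0<x_1<\cdots<x_r=b$. The height of $a$ is $h(a)=\ell(\bot,a)$, and $n=h(X)=\max_{x\in X}h(x)$ is the height of the poset. The levels are $X_r=\{x\in X: h(x)=r\}$ for $r\in\{0,\ldots,n\}$, and the top level is $\Omega=X_n$. The poset is called regular if the following hold. (R$\theta$) For all $r\in\{0,\ldots,n\}$, the number $\theta(r)=\#\{x\in\Omega: a\le x\}$ is the same for all $a\in X_r$. (R$\mu$) For all $r,s\in\{0,\ldots,n\}$, the number $\mu(r,s)=\#\{x\in X_s: a\le x\le b\}$ is the same for all $(a,b)\in X_r\times\Omega$ with $a\le b$. (R$\nu$) For all $r,s\in\{0,\ldots,n\}$, the number $\nu(r,s)=\#\{x\in X_r: x\le a\}$ is the same for all $a\in X_s$ (so $\nu(r,s)=0$ for $r>s$). The matrix $(\nu(r,s))_{r,s\in\{0,\ldots,n\}}$ is upper triangular with ones on the diagonal, hence invertible; its inverse is denoted $(\nu'(r,s))_{r,s\in\{0,\ldots,n\}}$. For $\beta:\Omega\to\mathbb{C}$ put $\#\beta=\sum_{x\in\Omega}\beta(x)$ and, for $a\in X$, $\lambda^{(\beta)}(a)=\sum_{x\in\Omega,\,a\le x}\beta(x)$. The function $\beta$ is a $t$-design of index $\lambda$ if $\lambda^{(\beta)}(a)=\lambda$ for all $a\in X_t$. It is a known fact that in a finite regular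 poset a $t$-design of index $\lambda$ is also an $s$-design for every $s\in\{0,\ldots,t\}$, with index $\lambda_s=\lambda\,\theta(s)/\theta(t)$. For $r\in\{0,\ldots,n\}$, the intersection numbers of $\beta$ with respect to $a\in X$ are $\alpha_r(a)=\sum_{y\in\Omega,\,h(y\wedge a)=r}\beta(y)$. *)

(* Defs.v *)
From HB Require Import structures.
From mathcomp Require Import all_boot all_order all_algebra.
From mathcomp Require Import reals complex.

Set Implicit Arguments.
Unset Strict Implicit.
Unset Printing Implicit Defensive.

Import Order.TTheory GRing.Theory.
Local Open Scope ring_scope.

Section Semilattice.
Variables (d : Order.disp_t) (X : finBMeetSemilatticeType d).
Implicit Types (a b x y : X) (r s : nat).

Definition has_chain a b r : bool :=
  [exists p : r.-tuple X, path <%O a p && (last a p == b)].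

(* The bound #|X| loses nothing; see has_chain_card. *)
Definition len a b : nat := \max_(r < #|X| | has_chain a b r) r.

Lemma has_chain_card a b r : has_chain a b r -> (r < #|X|)%N.
Proof.
case/existsP=> p /andP[pap _].
have /card_uniqP : uniq (a :: p) by apply: lt_sorted_uniq.
by rewrite /= size_tuple => <-; apply: max_card.
Qed.

Definition ht a : nat := len \bot%O a.

Definition pheight : nat := \max_(x : X) ht x.

Definition level r : {set X} := [set x | ht x == r].

Definition top_level : {set X} := level pheight.

(* X is regular, and theta, mu, nu are its parameters. *)
Record regular (theta : nat -> nat) (mu nu : nat -> nat -> nat) : Prop := {
  regular_theta : forall r, (r <= pheight)%N -> forall a, a \in level r ->
    #|[set x in top_level | (a <= x)%O]| = theta r;
  regular_mu : forall r s, (r <= pheight)%N -> (s <= pheight)%N ->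
    forall a b, a \in level r -> b \in top_level -> (a <= b)%O ->
    #|[set x in level s | (a <= x <= b)%O]| = mu r s;
  regular_nu : forall r s, (r <= pheight)%N -> (s <= pheight)%N ->
    forall a, a \in level s ->
    #|[set x in level r | (x <= a)%O]| = nu r s
}.

Section Weights.
(* Weights on the top level are represented by functions on all of X, whose
   values outside the top level are never used. *)
Variables (C : nzRingType) (beta : X -> C).

Definition total_weight : C := \sum_(x in top_level) beta x.

Definition cover_weight a : C := \sum_(x in top_level | (a <= x)%O) beta x.

Definition is_design (t : nat) (lam : C) : Prop :=
  forall a, a \in level t -> cover_weight a = lam.

Definition inter_number a r : C :=
  \sum_(y in top_level | ht (y `&` a)%O == r) beta y.

End Weights.
End Semilattice.

Arguments pheight {d} X.
Arguments level {d X} r.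
Arguments top_level {d} X.
Arguments regular {d} X theta mu nu.

Section Systems.
Variables (C : comUnitRingType) (n : nat) (nu : nat -> nat -> nat).
Implicit Types (r s t u : 'I_n.+1).

Definition nu_mx : 'M[C]_n.+1 := \matrix_(r, s) (nu r s)%:R.

(* For the nu of a regular semilattice of height n, nu_mx is upper
   unitriangular, so that invmx is a genuine inverse. *)
Definition nu' r s : C := invmx nu_mx r s.

(* Both systems are stated for arbitrary unknowns alpha; k is the height of
   the element a, and lam s is the index of the design at level s. *)
Definition mendelsohn t (k : nat) (lam : nat -> C) (alpha : nat -> C) : Prop :=
  forall r, (r <= t)%N ->
    \sum_(s < n.+1 | (r <= s)%N) (nu r s)%:R * alpha s = (nu r k)%:R * lam r.

Definition kohler t (k : nat) (lam : nat -> C) (alpha : nat -> C) : Prop :=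
  forall r, (r <= t)%N ->
    alpha r =
      \sum_(s < n.+1 | (r <= s <= t)%N) nu' r s * (nu s k)%:R * lam s
      - \sum_(u < n.+1 | (t < u)%N)
          (\sum_(s < n.+1 | (r <= s <= t)%N) nu' r s * (nu s u)%:R) * alpha u.

End Systems.
Arguments nu' C {n} nu r s.

(* Main.v *)
Require Import Defs.
From HB Require Import structures.
From mathcomp Require Import all_boot all_order all_algebra.
From mathcomp Require Import reals complex.

(** Everything comes from one double count ([sum_cover_weight]): summing the
    cover weights of the elements of a set P of poset elements gives each top
    element y the coefficient #{x in P : x <= y}.

    With P = {x in X_t : a <= x} and a in X_s, the coefficients are mu(s,t),
    so mu(s,t) times the cover weight of a is lam * #P.  The constant weight 1
    is a design of index theta(t), which gives
    mu(s,t) theta(s) = theta(t) #P, and eliminating #P shows that every t-design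
    is an s-design of index lam * theta(s) / theta(t) ([cover_weight_design]).
    The divisions are legitimate because a maximal chain meets every level, so
    that theta and mu are positive where they are used.

    With P = {x in X_r : x <= a}, the elements x of P below y are those below
    the meet of y and a, so the coefficient of y is nu(r, h(y /\ a)); grouping
    the top elements by h(y /\ a) gives the Mendelsohn equations.

    The rest is linear algebra on an upper unitriangular matrix U = (nu(r,s))
    with inverse V = (nu'(r,s)), which is upper triangular as well.  By
    triangularity the blocks of U and V on the indices <= t are inverse to each
    other ([trunc_mul_upper]).  Hence multiplying the first t+1 Mendelsohn
    equations by the block of V yields the Koehler equations, and multiplying
    by the block of U goes back.  The alternative form of the inner sum is the
    entry (r,u) of V U = 1, split at t. *)

Set Implicit Arguments.
Unset Strict Implicit.
Unset Printing Implicit Defensive.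

Import Order.TTheory GRing.Theory.
Local Open Scope ring_scope.

(** * Heights and levels *)

Section Height.
Variables (d : Order.disp_t) (X : finBMeetSemilatticeType d).
Implicit Types (a b x y : X) (r s t : nat).

Lemma has_chainP a b r :
  reflect (exists p : seq X, [/\ size p = r, path <%O%O a p & last a p = b])
          (has_chain a b r).
Proof.
apply: (iffP existsP) => [[p /andP[pap /eqP lap]]|[p [sp pap lap]]].
  by exists p; rewrite size_tuple.
by exists (Tuple (introT eqP sp)); rewrite /= pap lap eqxx.
Qed.

Lemma has_chain_trans a b c r s :
  has_chain a b r -> has_chain b c s -> has_chain a c (r + s).
Proof.
move=> /has_chainP[p [<- pap <-]] /has_chainP[q [<- pbq <-]].
by apply/has_chainP; exists (p ++ q); rewrite size_cat cat_path last_cat pap.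
Qed.

Lemma has_chain_lt a b : (a < b)%O -> has_chain a b 1.
Proof. by move=> ab; apply/has_chainP; exists [:: b]; rewrite /= ab. Qed.

Lemma has_chain_leq_len a b r : has_chain a b r -> (r <= len a b)%N.
Proof.
move=> abr; pose i := Ordinal (has_chain_card abr).
by rewrite /len (leq_bigmax_cond i).
Qed.

Lemma has_chain_ht x : has_chain \bot%O x (ht x).
Proof.
suff [r c0] : exists r, has_chain \bot%O x r.
  pose i := Ordinal (has_chain_card c0).
  by rewrite /ht /len (bigop.bigmax_eq_arg i) //; case: arg_maxnP.
have [<-|xN0] := eqVneq \bot%O x; last first.
  by exists 1%N; apply: has_chain_lt; rewrite lt_def eq_sym xN0 le0x.
by exists 0%N; apply/has_chainP; exists [::].
Qed.

Lemma ht_lt x y : (x < y)%O -> (ht x < ht y)%N.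
Proof.
move=> xy; have := has_chain_trans (has_chain_ht x) (has_chain_lt xy).
by rewrite addn1; apply: has_chain_leq_len.
Qed.

Lemma ht_le x y : (x <= y)%O -> (ht x <= ht y)%N.
Proof. by rewrite le_eqVlt => /predU1P[->//|/ht_lt/ltnW]. Qed.

Lemma ht_leq_pheight x : (ht x <= pheight X)%N.
Proof. exact: leq_bigmax. Qed.

(** The s-th member x of a longest chain from the bottom to b has height
    exactly s: a longer chain from the bottom to x, continued along the rest of
    the given one, would beat the height of b. *)
Lemma exists_below_ht b s : (s <= ht b)%N -> exists2 x, (x <= b)%O & ht x = s.
Proof.
move=> sb; have /has_chainP[p [sp pp lp]] := has_chain_ht b.
pose x := last \bot%O (take s p).
move: pp lp; rewrite -{1 2}(cat_take_drop s p) cat_path last_cat -/x.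
move=> /andP[ptake pdrop] ldrop.
have low : has_chain \bot%O x s.
  by apply/has_chainP; exists (take s p); rewrite size_takel // sp.
have high : has_chain x b (ht b - s).
  by apply/has_chainP; exists (drop s p); rewrite size_drop sp.
exists x.
  have /allP above := order_path_min lt_trans pdrop.
  by rewrite -ldrop; have /predU1P[->|/above/ltW] := mem_last x (drop s p).
apply/eqP; rewrite eqn_leq (has_chain_leq_len low) andbT.
have := has_chain_leq_len (has_chain_trans (has_chain_ht x) high).
by rewrite -/(ht b) -{2}(subnKC sb) leq_add2r.
Qed.

Lemma exists_top : exists b, b \in top_level X.
Proof.
rewrite /top_level /pheight (bigop.bigmax_eq_arg \bot%O) //.
by case: arg_maxnP => // b _ _; exists b; rewrite inE.
Qed.

(** Witnesses for the positivity of theta, mu and nu. *)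
Lemma exists_flag s t : (s <= t <= pheight X)%N ->
  exists x y b, [/\ x \in level s, y \in level t, b \in top_level X &
                   (x <= y <= b)%O].
Proof.
move=> /andP[st tn]; have [b bT] := exists_top.
have hb : ht b = pheight X by move: bT; rewrite inE => /eqP.
have [y yb hy] : exists2 y, (y <= b)%O & ht y = t.
  by apply: exists_below_ht; rewrite hb.
have [x xy hx] : exists2 x, (x <= y)%O & ht x = s.
  by apply: exists_below_ht; rewrite hy.
by exists x, y, b; rewrite !inE hx hy hb xy yb !eqxx.
Qed.

Lemma bot_level0 : (\bot%O : X) \in level 0%N.
Proof.
have [x] := @exists_below_ht \bot%O 0%N isT.
by rewrite lex0 inE => /eqP-> ->.
Qed.

End Height.

(** * Designs and intersection numbers *)

Section Designs.
Variables (d : Order.disp_t) (X : finBMeetSemilatticeType d).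
Variables (theta : nat -> nat) (mu nu : nat -> nat -> nat).
Hypothesis hX : regular X theta mu nu.
Implicit Types (a b x y : X) (r s t : nat).

Lemma theta_gt0 r : (r <= pheight X)%N -> (0 < theta r)%N.
Proof.
move=> rn; have [|x [y [b [xr _ bT /andP[xy yb]]]]] := @exists_flag _ X r r.
  by rewrite leqnn.
rewrite -(regular_theta hX rn xr); apply/card_gt0P; exists b.
by rewrite inE bT (le_trans xy).
Qed.

Lemma mu_gt0 s t : (s <= t <= pheight X)%N -> (0 < mu s t)%N.
Proof.
move=> stn; have /andP[st tn] := stn.
have [x [y [b [xs yt bT /andP[xy yb]]]]] := exists_flag stn.
rewrite -(regular_mu hX (leq_trans st tn) tn xs bT (le_trans xy yb)).
by apply/card_gt0P; exists y; rewrite inE yt xy yb.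
Qed.

Lemma nu_eq0 r s : (r <= pheight X)%N -> (s < r)%N -> nu r s = 0%N.
Proof.
move=> rn sr; have sn := leq_trans (ltnW sr) rn.
have [|x [_ [_ [xs _ _ _]]]] := @exists_flag _ X s s; first by rewrite leqnn.
rewrite -(regular_nu hX rn sn xs); apply/eqP; rewrite cards_eq0.
apply/eqP/setP => y; rewrite !inE; apply/negP => /andP[/eqP hy /ht_le].
by move: xs; rewrite inE hy => /eqP->; rewrite leqNgt sr.
Qed.

Lemma nu_diag r : (r <= pheight X)%N -> nu r r = 1%N.
Proof.
move=> rn; have [|x [_ [_ [xr _ _ _]]]] := @exists_flag _ X r r.
  by rewrite leqnn.
rewrite -(regular_nu hX rn rn xr) -(cards1 x); congr #|pred_of_set _|.
apply/setP => y; rewrite !inE; move: xr; rewrite inE => /eqP hx.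
apply/andP/eqP => [[/eqP hy]|->]; last by rewrite hx lexx eqxx.
by rewrite le_eqVlt => /predU1P[//|/ht_lt]; rewrite hx hy ltnn.
Qed.

Section Ring.
Variables (C : nzRingType) (beta : X -> C).

Lemma sum_cover_weight (P : pred X) :
  \sum_(x | P x) cover_weight beta x
    = \sum_(y in top_level X) #|[set x | P x & (x <= y)%O]|%:R * beta y.
Proof.
rewrite /cover_weight (exchange_big_dep (fun y => y \in top_level X)) //=;
  last by move=> x y _ /andP[].
apply: eq_bigr => y yT; rewrite sumr_const mulr_natl; congr (_ *+ _).
by apply: eq_card => x; rewrite [RHS]inE unfold_in yT.
Qed.

Lemma mu_cover_weight s t a : (s <= pheight X)%N -> (t <= pheight X)%N ->
  a \in level s ->
  (mu s t)%:R * cover_weight beta a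
    = \sum_(x in level t | (a <= x)%O) cover_weight beta x.
Proof.
move=> sn tn aL; rewrite sum_cover_weight mulr_sumr big_mkcondr /=.
apply: eq_bigr => y yT; case: ifPn => [ay|Nay].
  congr (_%:R * _); rewrite -(regular_mu hX sn tn aL yT ay).
  by apply: eq_card => x; rewrite !inE andbA.
(* A top element that is not above a is not above any x above a. *)
suff -> : [set x | (x \in level t) && (a <= x)%O & (x <= y)%O] = set0.
  by rewrite cards0 mul0r.
apply/setP => x; rewrite !inE; apply/negP => /andP[/andP[_ ax] xy].
by rewrite (le_trans ax xy) in Nay.
Qed.

Lemma total_weightE : total_weight beta = cover_weight beta \bot%O.
Proof. by apply: eq_bigl => x; rewrite le0x andbT. Qed.

Lemma sum_nu_inter_number r a : (r <= pheight X)%N ->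
  \sum_(s < (pheight X).+1 | (r <= s)%N) (nu r s)%:R * inter_number beta a s
    = \sum_(x in level r | (x <= a)%O) cover_weight beta x.
Proof.
move=> rn; rewrite sum_cover_weight big_mkcond /=.
pose h y : 'I_(pheight X).+1 := inord (ht (y `&` a)%O).
have hE y : h y = ht (y `&` a)%O :> nat by rewrite inordK // ltnS ht_leq_pheight.
rewrite [RHS](partition_big h predT) //=; apply: eq_bigr => s _.
have -> : (if (r <= s)%N then (nu r s)%:R * inter_number beta a s else 0)
            = (nu r s)%:R * inter_number beta a s.
  by case: leqP => // sr; rewrite nu_eq0 // mul0r.
rewrite /inter_number mulr_sumr; apply: eq_big => [y|y /andP[yT /eqP hy]].
  by rewrite -val_eqE /= hE.
have yL : (y `&` a)%O \in level s by rewrite inE hy.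
congr (_%:R * _); rewrite -(regular_nu hX rn (ltn_ord s : (s <= _)%N) yL).
by apply: eq_card => x; rewrite !inE lexI [(x <= y)%O && _]andbC andbA.
Qed.

Lemma mendelsohn_inter_number (lam : C) r a :
  (r <= pheight X)%N -> is_design beta r lam ->
  \sum_(s < (pheight X).+1 | (r <= s)%N) (nu r s)%:R * inter_number beta a s
    = (nu r (ht a))%:R * lam.
Proof.
move=> rn des; rewrite sum_nu_inter_number //.
rewrite (eq_bigr (fun=> lam)); last by move=> x /andP[/des].
have aL : a \in level (ht a) by rewrite inE.
rewrite sumr_const mulr_natl -(regular_nu hX rn (ht_leq_pheight a) aL).
by congr (_ *+ _); apply: eq_card => x; rewrite inE.
Qed.

End Ring.

Lemma cover_weight_design (F : numFieldType) (beta : X -> F) lam s t a :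
  (s <= t <= pheight X)%N -> is_design beta t lam -> a \in level s ->
  cover_weight beta a = (theta s)%:R / (theta t)%:R * lam.
Proof.
move=> stn des aL; have /andP[st tn] := stn; have sn := leq_trans st tn.
(* The constant weight 1 has cover weights theta, so the same identity for it
   evaluates the number of elements of level t above a. *)
have cover1 r x : (r <= pheight X)%N -> x \in level r ->
    cover_weight (fun=> 1 : F) x = (theta r)%:R.
  move=> rn xL; rewrite /cover_weight sumr_const -(regular_theta hX rn xL).
  by congr (_%:R); apply: eq_card => y; rewrite inE.
have muE (b : X -> F) l : is_design b t l -> (mu s t)%:R * cover_weight b a
    = #|[set x in level t | (a <= x)%O]|%:R * l.
  move=> bdes; rewrite (mu_cover_weight _ sn tn aL).
  rewrite (eq_bigr (fun=> l)); last by move=> x /andP[/bdes].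
  rewrite sumr_const mulr_natl; congr (_ *+ _).
  by apply: eq_card => x; rewrite inE.
have mu0 : (mu s t)%:R != 0 :> F by rewrite Num.Theory.pnatr_eq0 -lt0n mu_gt0.
have th0 : (theta t)%:R != 0 :> F by rewrite Num.Theory.pnatr_eq0 -lt0n theta_gt0.
have mu_theta := muE (fun=> 1) _ (fun x => cover1 t x tn).
rewrite (cover1 s) // in mu_theta.
apply: (mulfI mu0); rewrite (muE _ _ des) !mulrA mu_theta.
by rewrite mulfK.
Qed.

End Designs.

(** * Inverting a unitriangular system up to level t *)

Section Triangular.
Variables (C : comUnitRingType) (n : nat).
Implicit Types (A B : 'M[C]_n.+1) (p q r s t : 'I_n.+1).

Definition upper_mx A := forall r s, (s < r)%N -> A r s = 0.

Lemma unitriangular_unitmx A :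
  upper_mx A -> (forall r, A r r = 1) -> A \in unitmx.
Proof.
move=> upA A1; rewrite unitmxE -det_tr det_trig.
  by rewrite big1 ?unitr1 // => i _; rewrite mxE A1.
by apply/is_trig_mxP => i j ij; rewrite mxE upA.
Qed.

(** Row r of [B *m A = 1] is solved from left to right: below the diagonal, the
    s-th equation reduces to [B r s = 0] once the entries before it vanish. *)
Lemma upper_left_inverse A B :
  upper_mx A -> (forall r, A r r = 1) -> B *m A = 1%:M -> upper_mx B.
Proof.
move=> upA A1 BA r s; have [m] := ubnP s; elim: m s => // m IH s sm sr.
have /matrixP/(_ r s) := BA; rewrite !mxE [in r == s]eq_sym -val_eqE.
rewrite (ltn_eqF sr) (bigD1 s) //= A1 mulr1 big1 ?addr0 // => q.
rewrite -val_eqE neq_ltn => /orP[qs|sq]; last by rewrite upA ?mulr0.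
rewrite IH ?mul0r //; [exact: leq_trans qs _ | exact: ltn_trans qs sr].
Qed.

Lemma trunc_mul_upper A B t p r : upper_mx B -> A *m B = 1%:M -> (r <= t)%N ->
  \sum_(q < n.+1 | (q <= t)%N) A p q * B q r = (p == r)%:R.
Proof.
move=> upB /matrixP/(_ p r); rewrite !mxE => <- rt; rewrite big_mkcond /=.
apply: eq_bigr => q _; case: leqP => // tq.
by rewrite upB ?mulr0 // (leq_ltn_trans rt).
Qed.

Lemma sum_trunc_delta t p (f : 'I_n.+1 -> C) : (p <= t)%N ->
  \sum_(r < n.+1 | (r <= t)%N) (p == r)%:R * f r = f p.
Proof.
move=> pt; rewrite (bigD1 p) //= eqxx mul1r big1 ?addr0 // => r /andP[_].
by rewrite eq_sym => /negPf->; rewrite mul0r.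
Qed.

(** The leading block of [B] can be cancelled because that of [A] undoes it;
    this is what leads from the Koehler equations back to the Mendelsohn ones. *)
Lemma trunc_mul_inj A B t (f g : 'I_n.+1 -> C) :
  upper_mx B -> A *m B = 1%:M ->
  (forall r, (r <= t)%N ->
     \sum_(s < n.+1 | (s <= t)%N) B r s * f s
       = \sum_(s < n.+1 | (s <= t)%N) B r s * g s) ->
  forall r, (r <= t)%N -> f r = g r.
Proof.
move=> upB AB fg r rt.
have ABf (h : 'I_n.+1 -> C) : \sum_(q < n.+1 | (q <= t)%N)
    A r q * (\sum_(s < n.+1 | (s <= t)%N) B q s * h s) = h r.
  under eq_bigr do rewrite mulr_sumr.
  rewrite exchange_big /= -[RHS](sum_trunc_delta h rt).
  apply: eq_bigr => s st; rewrite -(trunc_mul_upper _ upB AB st) mulr_suml.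
  by apply: eq_bigr => q _; rewrite mulrA.
by rewrite -(ABf f) -(ABf g); apply: eq_bigr => q qt; rewrite fg.
Qed.

End Triangular.

Section Systems.
Variables (C : comUnitRingType) (n : nat) (nu : nat -> nat -> nat).
Hypothesis nu_upper : forall r s : 'I_n.+1, (s < r)%N -> nu r s = 0%N.
Hypothesis nu_diag1 : forall r : 'I_n.+1, nu r r = 1%N.
Implicit Types (r s t u : 'I_n.+1).

Let U : 'M[C]_n.+1 := nu_mx C n nu.
Let V : 'M[C]_n.+1 := invmx U.

Lemma nu_mx_upper : upper_mx U.
Proof. by move=> r s sr; rewrite mxE nu_upper. Qed.

Lemma nu_mx_diag r : U r r = 1.
Proof. by rewrite mxE nu_diag1. Qed.

Let U_unit : U \in unitmx := unitriangular_unitmx nu_mx_upper nu_mx_diag.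

Lemma nu'_upper : upper_mx V.
Proof. exact: upper_left_inverse nu_mx_upper nu_mx_diag (mulVmx U_unit). Qed.

Lemma sum_nu'_trunc r t (f : 'I_n.+1 -> C) :
  \sum_(s < n.+1 | (r <= s <= t)%N) nu' C nu r s * f s
    = \sum_(s < n.+1 | (s <= t)%N) V r s * f s.
Proof.
rewrite [LHS]big_mkcond [RHS]big_mkcond; apply: eq_bigr => s _.
by case: leqP => // sr; rewrite (nu'_upper sr) mul0r if_same.
Qed.

Lemma sum_nu_ge r (alpha : nat -> C) :
  \sum_(s < n.+1 | (r <= s)%N) (nu r s)%:R * alpha s
    = \sum_(s < n.+1) U r s * alpha s.
Proof.
rewrite [LHS]big_mkcond; apply: eq_bigr => s _; rewrite mxE.
by case: leqP => // sr; rewrite nu_upper // mul0r.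
Qed.

Lemma sum_nu'_nu_gt r t u : (r <= t)%N -> (t < u)%N ->
  \sum_(s < n.+1 | (r <= s <= t)%N) nu' C nu r s * (nu s u)%:R
    = - \sum_(s < n.+1 | (t < s <= u)%N) nu' C nu r s * (nu s u)%:R.
Proof.
move=> rt tu; apply/eqP; rewrite -addr_eq0 sum_nu'_trunc; apply/eqP.
have /matrixP/(_ r u) := mulVmx U_unit.
rewrite !mxE -val_eqE (ltn_eqF (leq_ltn_trans rt tu)) => VU0.
rewrite -[RHS]VU0 [RHS](bigID (fun s : 'I_n.+1 => (s <= t)%N)) /=; congr (_ + _).
  by apply: eq_bigr => s _; rewrite !mxE.
rewrite [LHS]big_mkcond [RHS]big_mkcond; apply: eq_bigr => s _.
rewrite -ltnNge mxE; case: (ltnP t s) => //= _; case: leqP => // us.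
by rewrite nu_upper // mulr0.
Qed.

(** Applying the leading block of V to the left-hand sides of the Mendelsohn
    equations isolates alpha r and leaves only the terms beyond t. *)
Lemma sum_nu'_mendelsohn r t (alpha : nat -> C) : (r <= t)%N ->
  \sum_(q < n.+1 | (q <= t)%N) V r q * (\sum_(s < n.+1) U q s * alpha s)
    = alpha r + \sum_(u < n.+1 | (t < u)%N)
        (\sum_(s < n.+1 | (r <= s <= t)%N) nu' C nu r s * (nu s u)%:R) * alpha u.
Proof.
move=> rt; under eq_bigr do rewrite mulr_sumr.
rewrite exchange_big /= (bigID (fun s : 'I_n.+1 => (s <= t)%N)) /=.
congr (_ + _).
  rewrite -[RHS](sum_trunc_delta (fun i : 'I_n.+1 => alpha i) rt).
  apply: eq_bigr => s st.
  rewrite -(trunc_mul_upper r nu_mx_upper (mulVmx U_unit) st) mulr_suml.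
  by apply: eq_bigr => q _; rewrite mulrA.
apply: eq_big => [u|u _]; first by rewrite ltnNge.
rewrite sum_nu'_trunc mulr_suml; apply: eq_bigr => q _.
by rewrite mulrA mxE.
Qed.

Lemma mendelsohn_kohler t k (lam alpha : nat -> C) :
  mendelsohn nu t k lam alpha <-> kohler nu t k lam alpha.
Proof.
pose f (r : 'I_n.+1) := \sum_(s < n.+1) U r s * alpha s.
pose g (r : 'I_n.+1) := (nu r k)%:R * lam r.
have kohlerE r : (r <= t)%N ->
    \sum_(s < n.+1 | (s <= t)%N) V r s * f s
      = \sum_(s < n.+1 | (s <= t)%N) V r s * g s <->
    alpha r = \sum_(s < n.+1 | (r <= s <= t)%N) nu' C nu r s * (nu s k)%:R * lam s
      - \sum_(u < n.+1 | (t < u)%N)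
          (\sum_(s < n.+1 | (r <= s <= t)%N) nu' C nu r s * (nu s u)%:R) * alpha u.
  move=> rt; rewrite sum_nu'_mendelsohn // -sum_nu'_trunc.
  under [in X in _ <-> X]eq_bigr do rewrite -mulrA.
  by split=> [<-|->]; rewrite ?addrK ?subrK.
split=> [M r rt|K r rt].
  apply/(kohlerE r rt); apply: eq_bigr => s st.
  by rewrite /f /g -M // sum_nu_ge.
rewrite sum_nu_ge; move: r rt.
apply: (trunc_mul_inj (f := f) (g := g) nu'_upper (mulmxV U_unit)).
by move=> r rt; apply/(kohlerE r rt)/K.
Qed.

End Systems.

(** * The two systems for the intersection numbers of a design *)

Theorem theorem2 (R : realType) (d : Order.disp_t)
    (X : finBMeetSemilatticeType d)
    (theta : nat -> nat) (mu nu : nat -> nat -> nat)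
    (hX : regular X theta mu nu)
    (t : 'I_(pheight X).+1) (beta : X -> R[i]) (lam : R[i])
    (hbeta : is_design beta t lam) (a : X) :
  (forall s : nat, (s <= t)%N -> exists lam_s : R[i], is_design beta s lam_s)
  /\
  forall lam_ : nat -> R[i],
    (forall s : nat, (s <= t)%N -> is_design beta s (lam_ s)) ->
    [/\ mendelsohn nu t (ht a) lam_ (inter_number beta a),
        (forall r : nat, (r <= t)%N ->
           (nu r (ht a))%:R * lam_ r
             = (nu r (ht a))%:R * ((theta r)%:R / (theta t)%:R) * lam
           /\ (nu r (ht a))%:R * lam_ r
             = (nu r (ht a))%:R * ((theta r)%:R / (theta 0%N)%:R)
                 * total_weight beta),
        kohler nu t (ht a) lam_ (inter_number beta a),
        (forall r u : 'I_(pheight X).+1, (r <= t)%N -> (t < u)%N ->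
           \sum_(s < (pheight X).+1 | (r <= s <= t)%N)
              nu' R[i] nu r s * (nu s u)%:R
           = - \sum_(s < (pheight X).+1 | (t < s <= u)%N)
                 nu' R[i] nu r s * (nu s u)%:R)
      & (forall alpha : nat -> R[i],
           mendelsohn nu t (ht a) lam_ alpha <-> kohler nu t (ht a) lam_ alpha)].
Proof.
have tn : (t <= pheight X)%N by rewrite -ltnS.
have cover s x : (s <= t)%N -> x \in level s ->
    cover_weight beta x = (theta s)%:R / (theta t)%:R * lam.
  by move=> st; apply: (cover_weight_design hX _ hbeta); rewrite st.
split=> [s st|lam_ des].
  by exists ((theta s)%:R / (theta t)%:R * lam) => x; apply: cover.
have lamE r : (r <= t)%N -> lam_ r = (theta r)%:R / (theta t)%:R * lam.
  (* Level r is nonempty, so an index at level r is unique. *)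
  move=> rt; have [|x [_ [_ [xr _ _ _]]]] := @exists_flag _ X r r.
    by rewrite leqnn (leq_trans rt).
  by rewrite -(des r rt x xr); apply: cover.
have nuU (r s : 'I_(pheight X).+1) : (s < r)%N -> nu r s = 0%N.
  by apply: (nu_eq0 hX); rewrite -ltnS.
have nuD (r : 'I_(pheight X).+1) : nu r r = 1%N.
  by apply: (nu_diag hX); rewrite -ltnS.
have M : mendelsohn nu t (ht a) lam_ (inter_number beta a).
  by move=> r rt; apply: (mendelsohn_inter_number hX); [rewrite -ltnS|apply: des].
split=> [//|r rt||r u|alpha].
- rewrite lamE // -!mulrA; split=> //; congr (_ * (_ * _)).
  rewrite total_weightE (cover 0%N) ?bot_level0 // mulrA mulrA mulVf ?mul1r //.
  by rewrite Num.Theory.pnatr_eq0 -lt0n (theta_gt0 hX).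
- exact/(mendelsohn_kohler nuU nuD).
- exact: (sum_nu'_nu_gt _ nuU nuD).
- exact: mendelsohn_kohler.
Qed.
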